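(* Let $E\subset F$ be a subobject in $\mathrm{Bmod}^{\mathfrak s}$, with $F^\sigma\subset E$. Then for $\xi\in F$ one has $\xi\in\overline{\mathrm{Im}}(E)$ if and only if there exists a finite sequence $a_0,a'_0,a_1,a'_1,\ldots,a_n,a_n'$ of elements of $E$ such that $$\xi=a_0+\xi,\quad p(a_j)=p(a'_j)\ \text{ and }\ a'_j+\xi=a_{j+1}+\xi\quad (0\le j<n),\quad p(a_n)=\xi+\sigma(\xi).$$
   Context: $\mathbb B=\{0,1\}$ is the Boolean semifield ($1+1=1$). A $\mathbb B$-module is a commutative monoid $(M,+,0)$ with $x+x=x$ for all $x$; morphisms are the monoid homomorphisms. $\mathrm{Bmod}^{\mathfrak s}$ is the category of $\mathbb B$-modules endowed with an involution $\sigma$ (an endomorphism with $\sigma^2=\mathrm{id}$), with morphisms the $\mathbb B$-module morphisms commuting with $\sigma$. A subobject is a $\sigma$-invariant submodule. $F^\sigma$ is the set of fixed points of $\sigma$ in $F$, and $p(x):=x+\sigma(x)$. For $h:L\to M$ in $\mathrm{Bmod}^{\mathfrak s}$, $\mathrm{Ker}(h):=h^{-1}(M^\sigma)$, and $\mathrm{Coker}(h):=M/\!\sim$ where $b\sim b'$ iff $g(b)=g(b')$ for every object $X$ and every morphism $g:M\to X$ of $\mathrm{Bmod}^{\mathfrak s}$ with $\mathrm{Range}(h)\subset\mathrm{Ker}(g)$. The normal image $\overline{\mathrm{Im}}(h)\subset M$ is the kernel of the quotient map $M\to\mathrm{Coker}(h)$. For a subobject $E\subset F$, $\overline{\mathrm{Im}}(E)\subset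 F$ denotes the normal image of the inclusion $E\to F$. *)

(* Defs.v *)
From HB Require Import structures.
From mathcomp Require Import all_boot all_order all_algebra.
From mathcomp Require Import boolp.

Set Implicit Arguments.
Unset Strict Implicit.
Unset Printing Implicit Defensive.

Import GRing.Theory.
Local Open Scope ring_scope.
Local Open Scope quotient_scope.

Reserved Notation "{ 'bmods' L -> M }"
  (at level 0, L at level 98, M at level 99, format "{ 'bmods'  L  ->  M }").

(* Modules over the Boolean semifield {0, 1} with 1 + 1 = 1: the scalar action
   of {0, 1} is forced, so only idempotency of the addition is required.
   Their morphisms are the monoid morphisms {additive L -> M}.                *)
HB.mixin Record Nmodule_isBmodule M of GRing.Nmodule M := {
  addbb : forall x : M, x + x = x
}.

#[short(type="bmodType")]
HB.structure Definition Bmodule := {M of Nmodule_isBmodule M & GRing.Nmodule M}.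

HB.mixin Record Bmodule_hasInvolution M of Bmodule M := {
  sigma : M -> M;
  sigma_is_nmod_morphism : nmod_morphism sigma;
  sigmaK : involutive sigma
}.

#[short(type="bmodsType")]
HB.structure Definition InvBmodule := {M of Bmodule_hasInvolution M & Bmodule M}.

HB.instance Definition _ (M : bmodsType) :=
  GRing.isNmodMorphism.Build M M (@sigma M) (@sigma_is_nmod_morphism M).

HB.mixin Record isSigmaMorphism (L M : bmodsType) (h : L -> M) := {
  morph_sigma : {morph h : x / sigma x}
}.

HB.structure Definition BmodsMorphism (L M : bmodsType) :=
  {h of isSigmaMorphism L M h & GRing.isNmodMorphism L M h}.

Notation "{ 'bmods' L -> M }" := (BmodsMorphism.type L%type M%type) : type_scope.

Definition fixed (M : bmodsType) : {pred M} := [pred x | sigma x == x].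
Arguments fixed M : clear implicits.

Definition psigma (M : bmodsType) (x : M) : M := x + sigma x.

HB.mixin Record isSigmaClosed (F : bmodsType) (E : {pred F}) := {
  rpred_sigma : {in E, forall x, sigma x \in E}
}.

#[short(type="bmodsClosed")]
HB.structure Definition BmodsClosed (F : bmodsType) :=
  {E of isSigmaClosed F E & GRing.AddClosed F E}.

Section SubObject.
Variables (F : bmodsType) (E : bmodsClosed F).

Record subobj : Type := Subobj { incl : F; inclP : incl \in E }.

HB.instance Definition _ := [isSub for incl].
HB.instance Definition _ := [Choice of subobj by <:].

Fact subobj_addr_closed : addr_closed (fun x => x \in E).
Proof. by split=> [|x y]; [apply: rpred0 | apply: rpredD]. Qed.

HB.instance Definition _ :=
  GRing.SubChoice_isSubNmodule.Build F (fun x => x \in E) subobj subobj_addr_closed.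

Fact subobj_addbb (x : subobj) : x + x = x.
Proof. by apply: val_inj; rewrite raddfD /= addbb. Qed.

HB.instance Definition _ := Nmodule_isBmodule.Build subobj subobj_addbb.

Definition subobj_sigma (x : subobj) : subobj :=
  Subobj (rpred_sigma (incl x) (inclP x)).

Fact subobj_sigma_is_nmod_morphism : nmod_morphism subobj_sigma.
Proof.
by split=> [|x y]; apply: val_inj; rewrite /= ?(raddf0, raddfD) //= raddf0.
Qed.

Fact subobj_sigmaK : involutive subobj_sigma.
Proof. by move=> x; apply: val_inj; rewrite /= sigmaK. Qed.

HB.instance Definition _ := Bmodule_hasInvolution.Build subobj
  subobj_sigma_is_nmod_morphism subobj_sigmaK.

Fact incl_is_nmod_morphism : nmod_morphism incl.
Proof. by split=> [|x y]; [exact: (raddf0 val) | exact: (raddfD val)]. Qed.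

HB.instance Definition _ :=
  GRing.isNmodMorphism.Build subobj F incl incl_is_nmod_morphism.

Fact incl_sigma : {morph incl : x / sigma x}.
Proof. by []. Qed.

HB.instance Definition _ := isSigmaMorphism.Build subobj F incl incl_sigma.

End SubObject.

Definition ker (L M : bmodsType) (h : {bmods L -> M}) : {pred L} :=
  [pred x | h x \in fixed M].

Section Cokernel.
Variables (L M : bmodsType) (h : {bmods L -> M}).

Definition coker_rel : rel M := fun b b' =>
  `[< forall (X : bmodsType) (g : {bmods M -> X}),
        (forall x : L, h x \in ker g) -> g b = g b' >].

Fact coker_rel_equiv : equiv_class_of coker_rel.
Proof.
split=> [x|x y|y x z].
- exact/asboolP.
- by apply/asboolP/asboolP=> H X g /H.
- by move=> /asboolP xy /asboolP yz; apply/asboolP=> X g gh; rewrite xy ?yz.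
Qed.

Canonical coker_equiv := EquivRelPack coker_rel_equiv.

Definition coker : Type := {eq_quot coker_equiv}.

HB.instance Definition _ := Choice.on coker.
HB.instance Definition _ := EqQuotient.on coker.

Definition coker_pi (x : M) : coker := \pi_coker x.

Fact coker_piP (x y : M) : reflect (coker_pi x = coker_pi y) (coker_rel x y).
Proof. by apply: (iffP idP) => [xy|/eqmodP//]; apply/eqmodP. Qed.

Fact coker_piK (u : coker) : coker_pi (repr u) = u.
Proof. exact: reprK. Qed.

Definition coker_add (u v : coker) : coker := coker_pi (repr u + repr v).
Definition coker_sigma (u : coker) : coker := coker_pi (sigma (repr u)).

Fact coker_piD x y : coker_pi (x + y) = coker_add (coker_pi x) (coker_pi y).
Proof.
have /asboolP Hx := introT (coker_piP _ _) (coker_piK (coker_pi x)).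
have /asboolP Hy := introT (coker_piP _ _) (coker_piK (coker_pi y)).
by apply/coker_piP/asboolP => X g gh; rewrite !raddfD /= (Hx X g gh) (Hy X g gh).
Qed.

Fact coker_pi_sigma x : coker_pi (sigma x) = coker_sigma (coker_pi x).
Proof.
have /asboolP Hx := introT (coker_piP _ _) (coker_piK (coker_pi x)).
by apply/coker_piP/asboolP => X g gh; rewrite !morph_sigma (Hx X g gh).
Qed.

Fact coker_addA : associative coker_add.
Proof.
move=> u v w; rewrite -(coker_piK u) -(coker_piK v) -(coker_piK w).
by rewrite -!coker_piD addrA.
Qed.

Fact coker_addC : commutative coker_add.
Proof. by move=> u v; rewrite /coker_add addrC. Qed.

Fact coker_add0 : left_id (coker_pi 0) coker_add.
Proof. by move=> u; rewrite -(coker_piK u) -coker_piD add0r. Qed.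

HB.instance Definition _ :=
  GRing.isNmodule.Build coker coker_addA coker_addC coker_add0.

Fact coker_addbb (u : coker) : u + u = u.
Proof. by rewrite -(coker_piK u) -[LHS]coker_piD addbb. Qed.

HB.instance Definition _ := Nmodule_isBmodule.Build coker coker_addbb.

Fact coker_sigma_is_nmod_morphism : nmod_morphism coker_sigma.
Proof.
split=> [|u v]; first by rewrite -[LHS]coker_pi_sigma raddf0.
rewrite -(coker_piK u) -(coker_piK v) -[X in coker_sigma X]coker_piD.
by rewrite -!coker_pi_sigma raddfD coker_piD.
Qed.

Fact coker_sigmaK : involutive coker_sigma.
Proof. by move=> u; rewrite -(coker_piK u) -!coker_pi_sigma sigmaK. Qed.

HB.instance Definition _ := Bmodule_hasInvolution.Build coker
  coker_sigma_is_nmod_morphism coker_sigmaK.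

Fact coker_pi_is_nmod_morphism : nmod_morphism coker_pi.
Proof. by split=> // x y; rewrite coker_piD. Qed.

HB.instance Definition _ :=
  GRing.isNmodMorphism.Build M coker coker_pi coker_pi_is_nmod_morphism.

HB.instance Definition _ :=
  isSigmaMorphism.Build M coker coker_pi coker_pi_sigma.

Definition normal_image : {pred M} := ker coker_pi.

End Cokernel.

Definition normal_image_sub (F : bmodsType) (E : bmodsClosed F) : {pred F} :=
  normal_image (@incl F E).

(* Main.v *)
Require Import Defs.
From mathcomp Require Import all_boot all_order all_algebra.
From HB Require Import structures.
From mathcomp Require Import boolp zify.

Set Implicit Arguments.
Unset Strict Implicit.
Unset Printing Implicit Defensive.

Import GRing.Theory.
Local Open Scope ring_scope.

(** Write [p] for [psigma].  A sigma-morphism [g] with [g(E)] fixed satisfies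
    [g a = g (p a)] on [E], so along a sequence as in the statement
    [g xi = g (a_j + xi)], whence [g xi = g (p xi)] is fixed.  Conversely, call
    [c] in [E] reachable if it ends such a sequence: these [c] form the class of 0
    for the congruence on [E] generated by [p c = p d] and [c + xi = d + xi].  The
    [y <= xi + c] with [c] reachable form an ideal meeting [E] in a
    sigma-invariant set, so the indicator of its complement, a morphism to the
    Boolean semifield, when paired with its conjugate sends [E] to fixed points.
    As [xi] is in the ideal, so is [sigma xi], which makes [p xi] reachable. *)

(* The product of two copies of the Boolean semifield, exchanged by sigma; an
   alias is needed since MathComp makes [bool] the field with two elements. *)
Definition bool2 : Type := (bool * bool)%type.

HB.instance Definition _ := Choice.on bool2.

Definition bool2_add (u v : bool2) : bool2 := (u.1 || v.1, u.2 || v.2).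
Definition bool2_swap (u : bool2) : bool2 := (u.2, u.1).

Fact bool2_addA : associative bool2_add.
Proof. by move=> [[] []] [[] []] [[] []]. Qed.

Fact bool2_addC : commutative bool2_add.
Proof. by move=> [[] []] [[] []]. Qed.

Fact bool2_add0 : left_id ((false, false) : bool2) bool2_add.
Proof. by case. Qed.

HB.instance Definition _ :=
  GRing.isNmodule.Build bool2 bool2_addA bool2_addC bool2_add0.

Fact bool2_addbb (u : bool2) : u + u = u.
Proof. by case: u => [[] []]. Qed.

HB.instance Definition _ := Nmodule_isBmodule.Build bool2 bool2_addbb.

Fact bool2_swap_is_nmod_morphism : nmod_morphism bool2_swap.
Proof. by []. Qed.

Fact bool2_swapK : involutive bool2_swap.
Proof. by case. Qed.

HB.instance Definition _ := Bmodule_hasInvolution.Build bool2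
  bool2_swap_is_nmod_morphism bool2_swapK.

(* The order is [x <= x + y]; left to right, [idealD] is downward closure. *)
Record ideal (F : bmodsType) := Ideal {
  ideal_mem :> F -> Prop;
  ideal0 : ideal_mem 0;
  idealD : forall x y, ideal_mem (x + y) <-> ideal_mem x /\ ideal_mem y
}.

Section IdealCharacter.
Variables (F : bmodsType) (I : ideal F).

Definition ideal_char (x : F) : bool2 := (~~ `[< I x >], ~~ `[< I (sigma x) >]).

Fact ideal_char_is_nmod_morphism : nmod_morphism ideal_char.
Proof.
have IDb x y : ~~ `[< I (x + y) >] = ~~ `[< I x >] || ~~ `[< I y >].
  by rewrite -negb_and -asbool_and (asbool_equiv_eq (idealD I x y)).
split=> [|x y]; rewrite /ideal_char ?raddf0 ?raddfD /= ?IDb //.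
by rewrite (asboolT (ideal0 I)).
Qed.

Fact ideal_char_sigma : {morph ideal_char : x / sigma x}.
Proof. by move=> x; rewrite /ideal_char sigmaK. Qed.

HB.instance Definition _ :=
  GRing.isNmodMorphism.Build F bool2 ideal_char ideal_char_is_nmod_morphism.
HB.instance Definition _ :=
  isSigmaMorphism.Build F bool2 ideal_char ideal_char_sigma.

End IdealCharacter.

(** The cokernel relation unfolds to this: the class of [xi] is fixed exactly when every [g] sending
    [E] to fixed points identifies [sigma xi] with [xi]. *)
Lemma normal_image_subP (F : bmodsType) (E : bmodsClosed F) (xi : F) :
  xi \in normal_image_sub E <->
  forall (X : bmodsType) (g : {bmods F -> X}),
    {in E, forall a, g (sigma a) = g a} -> g (sigma xi) = g xi.
Proof.
have kerE (X : bmodsType) (g : {bmods F -> X}) :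
    (forall x : subobj E, incl x \in ker g) <->
    {in E, forall a, g (sigma a) = g a}.
  split=> [gE a aE | gE x].
    by rewrite morph_sigma; apply/eqP/(gE (Subobj aE)).
  by apply/eqP; rewrite -morph_sigma gE ?inclP.
split=> [/eqP|xiE].
  by rewrite -morph_sigma => /coker_piP/asboolP H X g /kerE/H.
apply/eqP; rewrite -morph_sigma.
by apply/coker_piP/asboolP => X g /kerE/xiE.
Qed.

Lemma psigmaD (M : bmodsType) (x y : M) : psigma (x + y) = psigma x + psigma y.
Proof. by rewrite /psigma raddfD /= addrACA. Qed.

Lemma psigma_sigma (M : bmodsType) (x : M) : psigma (sigma x) = psigma x.
Proof. by rewrite /psigma sigmaK addrC. Qed.

Lemma sigma_psigma (M : bmodsType) (x : M) : sigma (psigma x) = psigma x.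
Proof. by rewrite /psigma raddfD /= sigmaK addrC. Qed.

Lemma psigma_fixed (M : bmodsType) (x : M) : psigma x \in fixed M.
Proof. exact/eqP/sigma_psigma. Qed.

Lemma psigma_idem (M : bmodsType) (x : M) : psigma (psigma x) = psigma x.
Proof. by rewrite {1}/psigma sigma_psigma Defs.addbb. Qed.

Section Reachable.
Variables (F : bmodsType) (E : bmodsClosed F) (xi : F).

Inductive reachable : F -> Prop :=
| reachable_base c : c \in E -> xi = c + xi -> reachable c
| reachable_step c c' d : reachable c -> c' \in E -> d \in E ->
    psigma c = psigma c' -> c' + xi = d + xi -> reachable d.

Lemma reachable_sub c : reachable c -> c \in E.
Proof. by case. Qed.

Lemma reachable0 : reachable 0.
Proof. by apply: reachable_base; rewrite ?rpred0 ?add0r. Qed.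

(** One half of a step, taken with [c' = c]; the next lemma is the other half, with [c' = d]. *)
Lemma reachable_add_eq c d :
  reachable c -> d \in E -> c + xi = d + xi -> reachable d.
Proof.
by move=> cR dE; apply: (reachable_step cR) => //; apply: reachable_sub.
Qed.

Lemma reachable_psigma_eq c d :
  reachable c -> d \in E -> psigma c = psigma d -> reachable d.
Proof. by move=> cR dE cd; apply: (reachable_step cR dE). Qed.

Lemma reachableD c d : reachable c -> reachable d -> reachable (c + d).
Proof.
move=> cR; have cE := reachable_sub cR.
elim=> [{}d dE xid | b b' {}d _ IH b'E dE bb' b'd].
  by apply: (reachable_add_eq cR); rewrite ?rpredD // -addrA -xid.
(* The whole step from [b] to [d] is translated by [c]. *)
apply: (reachable_step IH (c' := c + b')); rewrite ?rpredD //.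
  by rewrite !psigmaD bb'.
by rewrite -!addrA b'd.
Qed.

(** Steps are reversible and compatible with adding [d], so the path leading to [c] can be retraced
    from [d + c] back to [d]. *)
Lemma reachable_addr_inv c d :
  d \in E -> reachable c -> reachable (d + c) -> reachable d.
Proof.
move=> dE; elim=> [{}c cE xic | b b' {}c bR IH b'E cE bb' b'c] dcR.
  by apply: (reachable_add_eq dcR); rewrite // -addrA -xic.
have bE := reachable_sub bR.
apply: IH; apply: (@reachable_psigma_eq (d + b')); rewrite ?rpredD //.
  by apply: (reachable_add_eq dcR); rewrite ?rpredD // -!addrA b'c.
by rewrite !psigmaD bb'.
Qed.

Lemma reachable_seq d : reachable d ->
  exists (n : nat) (a a' : nat -> F),
    [/\ forall j : nat, (j <= n)%N -> a j \in E /\ a' j \in E,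
        xi = a 0%N + xi,
        forall j : nat, (j < n)%N ->
          psigma (a j) = psigma (a' j) /\ a' j + xi = a j.+1 + xi
      & a n = d].
Proof.
elim=> [{}d dE xid | c c' {}d _ [n [a [a' [aE a0 aS an]]]] c'E dE cc' c'd].
  by exists 0%N, (fun=> d), (fun=> d); split.
(* The cutoffs differ because [c'] becomes [a' n] while [d] becomes [a n.+1]. *)
exists n.+1, (fun j => if (j <= n)%N then a j else d),
  (fun j => if (j < n)%N then a' j else c'); split=> // [j jn | j jn |].
- by split; case: ifP => // jn'; have [] := aE j; lia.
- have jn' : (j <= n)%N := jn; rewrite jn'.
  have [jltn|nlej] := ltnP j n; first exact: aS.
  have -> : j = n by lia.
  by rewrite an.
- by rewrite ltnn.
Qed.

Definition below_reachable (y : F) : Prop :=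
  exists2 c, reachable c & y + (c + xi) = c + xi.

Lemma below_reachable0 : below_reachable 0.
Proof. by exists 0; [exact: reachable0 | rewrite add0r]. Qed.

Lemma below_reachable_xi : below_reachable xi.
Proof. by exists 0; [exact: reachable0 | rewrite add0r Defs.addbb]. Qed.

Lemma below_reachableD x y :
  below_reachable (x + y) <-> below_reachable x /\ below_reachable y.
Proof.
split=> [[c cR xyc] | [[c cR xc] [d dR yd]]].
  split; exists c => //; rewrite -{1}xyc addrA.
    by rewrite [x + (x + y)]addrA Defs.addbb xyc.
  by rewrite [y + (x + y)]addrCA Defs.addbb xyc.
exists (c + d); first exact: reachableD.
have -> : x + y + (c + d + xi) = x + (c + xi) + (y + (d + xi)).
  by rewrite [RHS]addrACA [c + xi + _]addrACA Defs.addbb.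
by rewrite xc yd addrACA Defs.addbb.
Qed.

Definition reach_ideal : ideal F := Ideal below_reachable0 below_reachableD.

(** As [a + c + xi = c + xi], the sum [a + c] is reachable along with [c], and [c] can then be
    cancelled. *)
Lemma reachable_of_below a : a \in E -> below_reachable a -> reachable a.
Proof.
move=> aE [c cR ac]; apply: (reachable_addr_inv _ cR) => //.
apply: (reachable_add_eq cR); first by rewrite rpredD // reachable_sub.
by rewrite -addrA ac.
Qed.

Lemma below_reachable_sigma a :
  a \in E -> below_reachable a -> below_reachable (sigma a).
Proof.
move=> aE /(reachable_of_below aE) aR; exists (sigma a).
  by apply: (reachable_psigma_eq aR); rewrite ?rpred_sigma ?psigma_sigma.
by rewrite addrA Defs.addbb.
Qed.

End Reachable.

(* The sequence a_0, a'_0, ..., a_n, a'_n is given by the values at 0, ..., n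
   of two functions on nat; their values beyond n are irrelevant. *)
Theorem proposition1p7 (F : bmodsType) (E : bmodsClosed F)
    (fixE : {subset fixed F <= E}) (xi : F) :
  xi \in normal_image_sub E <->
  exists (n : nat) (a a' : nat -> F),
    [/\ forall j : nat, (j <= n)%N -> a j \in E /\ a' j \in E,
        xi = a 0%N + xi,
        forall j : nat, (j < n)%N ->
          psigma (a j) = psigma (a' j) /\ a' j + xi = a j.+1 + xi
      & psigma (a n) = xi + sigma xi].
Proof.
rewrite normal_image_subP; split=> [H | [n [a [a' [aE a0 aS an]]]] X g gE].
  pose g := ideal_char (reach_ideal E xi).
  have gE : {in E, forall b, g (sigma b) = g b}.
    move=> b bE; rewrite /g /= /ideal_char sigmaK.
    (* [sigma] swaps the two coordinates of [g b], so these must agree. *)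
    suff -> : `[< below_reachable E xi (sigma b) >] =
              `[< below_reachable E xi b >] by [].
    apply: asbool_equiv_eq; split=> [|]; last exact: below_reachable_sigma.
    by rewrite -{2}[b]sigmaK; apply: below_reachable_sigma; rewrite rpred_sigma.
  have [c cR xic] : below_reachable E xi (sigma xi).
    have [/negb_inj sxi _] := H _ g gE.
    by apply/asboolP; rewrite sxi; apply/asboolP/below_reachable_xi.
  (* [psigma xi] lies in [E] because it is fixed, and in the ideal as a sum of two members. *)
  have pxi : reachable E xi (psigma xi).
    apply: reachable_of_below; first exact/fixE/psigma_fixed.
    by apply/below_reachableD; split; [exact: below_reachable_xi | exists c].
  have [n [a [a' [aE a0 aS an]]]] := reachable_seq pxi.
  by exists n, a, a'; split; rewrite // an psigma_idem.
have gD x y : g (x + y) = g x + g y by exact: raddfD.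
have gp b : b \in E -> g (psigma b) = g b.
  by move=> bE; rewrite gD gE // Defs.addbb.
have gxi j : (j <= n)%N -> g (a j + xi) = g xi.
  elim: j => [_|j IH jn]; first by rewrite -a0.
  have [pj <-] := aS j jn.
  have [ajE a'jE] := aE j (ltnW jn).
  (* On [E], [g] depends only on [psigma], so [a j] may replace [a' j]. *)
  rewrite gD -(gp _ a'jE) -pj (gp _ ajE) -gD.
  exact/IH/ltnW.
have [anE _] := aE n (leqnn n).
have gpxi : g (psigma xi) = g xi.
  (* Here [g xi = g (psigma xi + xi)], and [psigma xi] absorbs [xi]. *)
  rewrite -[RHS](gxi n) // [RHS]gD -(gp _ anE) an -gD.
  by rewrite addrAC Defs.addbb.
by rewrite morph_sigma -gpxi -morph_sigma sigma_psigma.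
Qed.
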